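(* Let $\mathcal{H}$ be a real Hilbert space, let $F:\mathcal{H}\rightrightarrows\mathcal{H}$ be a set-valued mapping with $\operatorname{zer}F\neq\varnothing$, let $(\gamma_n)_{n\in\mathbb{N}}$ be a sequence of positive real numbers, and let $v:\mathcal{H}\to\mathcal{H}$ be an injective single-valued mapping defined on all of $\mathcal{H}$ such that the pair $(F,v)$ is monotone and $\operatorname{ran}v\subseteq\operatorname{ran}(\gamma_nF+v)$ for all $n\in\mathbb{N}$. Let $x_0\in\mathcal{H}$ be arbitrary and let $(x_n)_{n\in\mathbb{N}}$ be generated by $$x_{n+1}=J_{\gamma_nF}^v(x_n),\qquad n\ge 0.$$ (i) If $F$ has a strongly-weakly closed graph, $v^{-1}$ is well-defined and weakly continuous, and $\sum_{n=0}^{+\infty}\gamma_n^2=+\infty$, then $(x_n)_{n\in\mathbb{N}}$ converges weakly to a solution of $0\in F(x)$. (ii) If the pair $(F,v)$ is $\alpha$-strongly monotone for some $\alpha\in(0,+\infty)$ and $\gamma:=\inf_{n\in\mathbb{N}}\gamma_n>0$, then $(x_n)_{n\in\mathbb{N}}$ converges strongly to the unique solution $x^*$ of $0\in F(x)$. Moreover: (a) If $v$ is $L$-Lipschitz continuous with $L\in(0,+\infty)$, then $(v(x_n))_{n\in\mathbb{N}}$ converges to $v(x^* )$ with linear rate $\frac{1}{1+\alpha\gamma L^{-2}}$, i.e. $\|v(x_{n+1})-v(x^* )\|\le\frac{1}{1+\alpha\gamma L^{-2}}\|v(x_n)-v(x^* )\|$ for all $n\in\mathbb{N}$. (b) If $v$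 is $L$-Lipschitz continuous with $L\in(0,+\infty)$ and $v^{-1}$ is well-defined and $\ell$-Lipschitz continuous, then $(x_n)_{n\in\mathbb{N}}$ converges to $x^*$ with linear rate, i.e. there exist $C\ge 0$ and $\kappa\in(0,1)$ such that $\|x_n-x^*\|\le C\kappa^n$ for all $n\in\mathbb{N}$.
   Context: For a set-valued mapping $F:\mathcal{H}\rightrightarrows\mathcal{H}$: $\operatorname{ran}F=\bigcup_xF(x)$, $\operatorname{zer}F=\{x:0\in F(x)\}$, $\operatorname{gra}F=\{(x,y):y\in F(x)\}$, $F^{-1}(y)=\{x:y\in F(x)\}$. Warped resolvent: $J_{\gamma F}^v=(\gamma F+v)^{-1}\circ v$, i.e. $J_{\gamma F}^v(x)=\{y: v(x)\in\gamma F(y)+v(y)\}$. When $(F,v)$ is monotone, $v$ is injective and $\operatorname{ran}v\subseteq\operatorname{ran}(\gamma F+v)$, this set is a singleton for every $x\in\mathcal{H}$, and $J_{\gamma F}^v(x)$ denotes its element. The pair $(F,v)$ is monotone if $\langle x^*-y^*, v(x)-v(y)\rangle\ge 0$ for all $x,y\in\mathcal{H}$, $x^*\in F(x)$, $y^*\in F(y)$; it is $\alpha$-strongly monotone ($\alpha>0$) if $\langle x^*-y^*, v(x)-v(y)\rangle\ge\alpha\|x-y\|^2$ for all such $x,y,x^*,y^*$. $F$ has a strongly-weakly closed graph if whenever $(x_n,y_n)\in\operatorname{gra}F$ with $x_n\rightharpoonup x$ (weakly) and $y_n\to y$ (strongly), one has $y\in F(x)$. A single-valued map $G:\mathcal{H}\to\mathcal{H}$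 is weakly continuous if $x_n\rightharpoonup x$ implies $G(x_n)\rightharpoonup G(x)$ for every sequence $(x_n)$. ''$v^{-1}$ is well-defined'' means that $v$ is bijective from $\mathcal{H}$ onto $\mathcal{H}$. *)

(* Defs.v *)
From mathcomp Require Export all_boot all_order all_algebra.
From mathcomp Require Export all_classical all_reals all_analysis.

Set Implicit Arguments.
Unset Strict Implicit.
Unset Printing Implicit Defensive.

Export Order.TTheory GRing.Theory Num.Theory.
Export numFieldNormedType.Exports.

Local Open Scope classical_set_scope.
Local Open Scope ring_scope.

(* A real Hilbert space is a complete normed module [H] over the reals whose
   norm is induced by an inner product [dot : {dot H for idfun}]. *)
Definition hilbert_norm (R : realType) (H : completeNormedModType R)
    (dot : {dot H for idfun}) : Prop :=
  forall x : H, `|x| = Num.sqrt (dot x x).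

Definition weakly_cvg (R : realType) (H : completeNormedModType R)
    (dot : {dot H for idfun}) (x : nat -> H) (l : H) : Prop :=
  forall u : H, dot (x n) u @[n --> \oo] --> dot l u.

Definition weakly_continuous (R : realType) (H : completeNormedModType R)
    (dot : {dot H for idfun}) (G : H -> H) : Prop :=
  forall (x : nat -> H) (l : H),
    weakly_cvg dot x l -> weakly_cvg dot (G \o x) (G l).

(* Set-valued mappings on [H] are functions [H -> set H]. *)

Definition ran (H : Type) (F : H -> set H) : set H := \bigcup_x F x.

Definition zer (R : realType) (H : completeNormedModType R)
    (F : H -> set H) : set H := [set x | F x 0].

Definition gra (H : Type) (F : H -> set H) : set (H * H) :=
  [set p | F p.1 p.2].

Definition set_valued_inv (H : Type) (F : H -> set H) : H -> set H :=
  fun y => [set x | F x y].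

Definition strongly_weakly_closed (R : realType) (H : completeNormedModType R)
    (dot : {dot H for idfun}) (F : H -> set H) : Prop :=
  forall (x y : nat -> H) (lx ly : H),
    (forall n, gra F (x n, y n)) ->
    weakly_cvg dot x lx -> y n @[n --> \oo] --> ly -> F lx ly.

Definition monotone_pair (R : realType) (H : completeNormedModType R)
    (dot : {dot H for idfun}) (F : H -> set H) (v : H -> H) : Prop :=
  forall x y xs ys : H, F x xs -> F y ys ->
    0 <= dot (xs - ys) (v x - v y).

Definition strongly_monotone_pair (R : realType) (H : completeNormedModType R)
    (dot : {dot H for idfun}) (alpha : R) (F : H -> set H) (v : H -> H) :
    Prop :=
  forall x y xs ys : H, F x xs -> F y ys ->
    alpha * `|x - y| ^+ 2 <= dot (xs - ys) (v x - v y).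

(* The set-valued mapping gamma F + v. *)
Definition warped_sum (R : realType) (H : completeNormedModType R)
    (gamma : R) (F : H -> set H) (v : H -> H) : H -> set H :=
  fun x => [set gamma *: u + v x | u in F x].

Definition warped_resolvent_set (R : realType) (H : completeNormedModType R)
    (gamma : R) (F : H -> set H) (v : H -> H) : H -> set H :=
  set_valued_inv (warped_sum gamma F v) \o v.

(* [get A] is an element of [A] if [A] is nonempty and a junk value otherwise;
   [warped_resolvent_setE] shows that the junk value is never used under the
   standing assumptions, and that the element is then unique. *)
Definition warped_resolvent (R : realType) (H : completeNormedModType R)
    (gamma : R) (F : H -> set H) (v : H -> H) : H -> H :=
  fun x => get (warped_resolvent_set gamma F v x).

Lemma warped_resolvent_setE (R : realType) (H : completeNormedModType R)
    (dot : {dot H for idfun}) (gamma : R) (F : H -> set H) (v : H -> H) :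
  0 < gamma -> monotone_pair dot F v -> injective v ->
  range v `<=` ran (warped_sum gamma F v) ->
  forall x, warped_resolvent_set gamma F v x =
            [set warped_resolvent gamma F v x].
Proof.
move=> g0 mono inj sub x.
have [|y0 _ y0P] := sub (v x); first by exists x.
have Jx : warped_resolvent_set gamma F v x (warped_resolvent gamma F v x).
  by apply: (@getPex _ (warped_resolvent_set gamma F v x)); exists y0.
apply/seteqP; split=> [y Jy|y ->//] /=.
move: (warped_resolvent _ _ _ _) Jx Jy => z [a Fa za] [b Fb yb].
have := mono _ _ _ _ Fb Fa.
have -> : v y - v z = (- gamma) *: (b - a).
  apply/eqP; rewrite scaleNr scalerBr opprB subr_eq addrAC eq_sym subr_eq.
  by rewrite [v y + _]addrC; apply/eqP; rewrite za yb.
rewrite linearZ /= mulNr oppr_ge0 pmulr_rle0// => le0.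
have /eqP : b - a = 0.
  apply/eqP/contraT => ba0.
  by have := neq0_dnorm_gt0 (s := dot) _ ba0; rewrite ltNge le0.
rewrite subr_eq0 => /eqP ba.
by apply: inj; move: yb; rewrite ba -za => /addrI.
Qed.

(* Main.v *)
Require Import Defs.
From mathcomp Require Import ring lra.

(* Put w_n = v (x_n) and u_n = (w_n - w_{n+1}) / gamma_n, an element of
   F (x_{n+1}). For a zero z of F, monotonicity against (z, 0) gives
     |w_{n+1} - v z|^2 + gamma_n^2 |u_n|^2 <= |w_n - v z|^2,
   so w is Fejer monotone with respect to v (zer F) and the sum of
   gamma_n^2 |u_n|^2 is finite. Monotonicity between consecutive iterates makes
   |u_n| nonincreasing, so u_n --> 0 as soon as the sum of gamma_n^2 diverges;
   weak cluster points of w then lie in v (zer F), and Opial's argument gives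
   weak convergence of w, hence of x through the weakly continuous inverse of v.
   Under strong monotonicity the term 2 gamma_n <u_n, w_{n+1} - v z> dropped
   above dominates 2 gamma_n alpha |x_{n+1} - z|^2. *)

Set Implicit Arguments.
Unset Strict Implicit.
Unset Printing Implicit Defensive.

Local Open Scope classical_set_scope.
Local Open Scope ring_scope.

(** * Inner product geometry, Riesz representation, weak sequential compactness *)

Section InnerProduct.
Context (R : realType) (H : completeNormedModType R) (dot : {dot H for idfun}).

Lemma dotC x y : dot x y = dot y x.
Proof. by rewrite hermC /= expr0 mul1r. Qed.

Lemma dotDl x y z : dot (x + y) z = dot x z + dot y z.
Proof. exact: linearDl. Qed.

Lemma dotDr x y z : dot z (x + y) = dot z x + dot z y.
Proof. exact: linearDr. Qed.

Lemma dotBl x y z : dot (x - y) z = dot x z - dot y z.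
Proof. exact: linearBl. Qed.

Lemma dotBr x y z : dot z (x - y) = dot z x - dot z y.
Proof. exact: linearBr. Qed.

Lemma dotZl a x z : dot (a *: x) z = a * dot x z.
Proof. exact: linearZl_LR. Qed.

Lemma dotZr a x z : dot z (a *: x) = a * dot z x.
Proof. by rewrite dotC dotZl dotC. Qed.

Definition dotE := (dotBl, dotBr, dotDl, dotDr, dotZl, dotZr).

Lemma dot_ge0 x : 0 <= dot x x.
Proof.
have [->|/neq0_dnorm_gt0/ltW//] := eqVneq x 0.
by rewrite linear0r.
Qed.

Hypothesis hH : hilbert_norm dot.

Lemma dot_norm x : dot x x = `|x| ^+ 2.
Proof. by rewrite hH sqr_sqrtr// dot_ge0. Qed.

Lemma dot_eq0 x : dot x x = 0 -> x = 0.
Proof. by rewrite dot_norm => /eqP; rewrite sqrf_eq0 normr_eq0 => /eqP. Qed.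

Lemma cauchy_schwarz x y : `|dot x y| <= `|x| * `|y|.
Proof.
have [->|y0] := eqVneq y 0; first by rewrite linear0r !normr0 mulr0.
have y2 : 0 < dot y y by exact: neq0_dnorm_gt0.
rewrite -ler_sqr ?nnegrE ?mulr_ge0// real_normK ?num_real// exprMn -!dot_norm.
(* This is [dot y y] times the component of [x] orthogonal to [y]; the scaling avoids division. *)
have := dot_ge0 (dot y y *: x - dot x y *: y).
rewrite !dotE [dot y x]dotC.
set e := (X in 0 <= X); suff -> : e =
   dot y y * (dot x x * dot y y - dot x y ^+ 2).
  by rewrite pmulr_rge0// subr_ge0.
rewrite /e; ring.
Qed.

Lemma dot_le x y : dot x y <= `|x| * `|y|.
Proof. by rewrite (le_trans (ler_norm _))// cauchy_schwarz. Qed.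

Lemma cvg_weakly_cvg (x : nat -> H) l :
  x n @[n --> \oo] --> l -> weakly_cvg dot x l.
Proof.
move=> xl u; apply/cvgrPdist_le => e e0.
have d0 : 0 < e / (`|u| + 1) by rewrite divr_gt0// ltr_wpDl.
move/cvgrPdist_le : xl => /(_ _ d0); apply: filterS => n xn.
rewrite -dotBl (le_trans (cauchy_schwarz _ _))//.
rewrite (le_trans (ler_wpM2r _ xn))// mulrAC ler_pdivrMr ?ltr_wpDl//.
by rewrite ler_pM2l// lerDl.
Qed.

(* The representer minimises [|y|^2 - 2 phi y] over [S]. *)
Lemma riesz_closed_subspace (S : set H) (phi : H -> R) (C : R) :
  closed S -> S 0 -> (forall x y, S x -> S y -> S (x + y)) ->
  (forall a x, S x -> S (a *: x)) ->
  (forall x y, S x -> S y -> phi (x + y) = phi x + phi y) ->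
  (forall a x, S x -> phi (a *: x) = a * phi x) ->
  (forall x, S x -> `|phi x| <= C * `|x|) ->
  exists2 w, S w & forall s, S s -> phi s = dot w s.
Proof.
move=> clS S0 SD SZ phiD phiZ phiC.
pose g y := dot y y - 2 * phi y.
(* [g y] is at least [|y|^2 - 2 C |y|]; complete the square. *)
have glb : lbound (g @` S) (- C ^+ 2).
  move=> _ [y Sy <-]; rewrite /g dot_norm.
  have := phiC _ Sy; have := ler_norm (phi y); have := sqr_ge0 (`|y| - C).
  rewrite sqrrB; nra.
have ginf : has_inf (g @` S).
  by split; [exists (g 0); exists 0|exists (- C ^+ 2)].
set m := inf (g @` S).
have mg y : S y -> m <= g y.
  by move=> Sy; apply: ge_inf; [exists (- C ^+ 2)|exists y].
have /choice[y yP] n : exists y, S y /\ g y < m + harmonic n.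
  have [_ [y Sy <-] gy] := inf_adherent (@harmonic_gt0 R n) ginf.
  by exists y.
(* Parallelogram law: the midpoint lies in [S], where [g] equals the mean of [g (y i)] and [g (y j)]
   minus [|y i - y j|^2 / 4], and is still at least [m]. *)
have ydist i j : `|y i - y j| ^+ 2 <= 2 * (harmonic i + harmonic j).
  have [Si gi] := yP i; have [Sj gj] := yP j.
  have := mg _ (SZ 2^-1 _ (SD _ _ Si Sj)).
  rewrite /g phiZ ?phiD//; last exact: SD.
  move: gi gj; rewrite /g -dot_norm !dotE [dot (y j) (y i)]dotC.
  move: (harmonic i) (harmonic j) => a b; lra.
have ycvg : cvgn y.
  apply/cauchy_cvgP/cauchy_exP => e e0.
  have e24 : 0 < e ^+ 2 / 4 by rewrite divr_gt0// exprn_gt0.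
  have [N _ NP] := near_infty_natSinv_lt (PosNum e24).
  exists (y N); exists N => //= n Nn.
  rewrite -ball_normE /= -ltr_sqr ?nnegrE// ?(ltW e0)//.
  have := NP n Nn; have := NP N (leqnn N); have := ydist N n => /=.
  rewrite /harmonic /=; move: (N.+1%:R^-1) (n.+1%:R^-1) => a b; lra.
have Slim : S (limn y).
  by apply: (@closed_cvg _ _ _ _ _ _ clS _ _ ycvg); near=> n; case: (yP n).
exists (limn y) => // s Ss.
(* First-order optimality: compare [g (y n + t s)] with [m] and let [n] tend to infinity. *)
have key t : 0 <= t ^+ 2 * dot s s + 2 * t * (dot (limn y) s - phi s).
  apply: (@cvgr_to_ge _ \oo _ _ (fun n => harmonic n +
     (t ^+ 2 * dot s s + 2 * t * (dot (y n) s - phi s)))).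
    rewrite -[X in _ --> X]add0r; apply: cvgD; first exact: cvg_harmonic.
    apply: cvgD; first exact: cvg_cst.
    apply: cvgM; first exact: cvg_cst.
    apply: cvgB; last exact: cvg_cst.
    exact: cvg_weakly_cvg ycvg s.
  near=> n; have [Sn gn] := yP n.
  have := mg _ (SD _ _ Sn (SZ t _ Ss)).
  move: gn; rewrite /g phiD ?phiZ//; last exact: SZ.
  rewrite !dotE [dot s (y n)]dotC; move: (harmonic n) => a.
  nra.
have s1 : 0 < dot s s + 1 by rewrite ltr_wpDl// dot_ge0.
(* A step against the linear coefficient makes the quadratic negative unless that coefficient
   vanishes; the [+ 1] covers [s = 0]. *)
have := key (- (dot (limn y) s - phi s) / (dot s s + 1)).
set d := _ - phi s.
suff d2 : 0 <= (- (d / (dot s s + 1)) ^+ 2) * (dot s s + 2) -> d = 0.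
  have -> : (- d / (dot s s + 1)) ^+ 2 * dot s s +
     2 * (- d / (dot s s + 1)) * d =
     (- (d / (dot s s + 1)) ^+ 2) * (dot s s + 2).
    by field; rewrite gt_eqF.
  by move/d2/eqP; rewrite subr_eq0 => /eqP.
rewrite mulNr oppr_ge0 pmulr_lle0 ?ltr_wpDl ?dot_ge0//.
rewrite real_exprn_even_le0 ?num_real//= mulf_eq0 invr_eq0 (gt_eqF s1) orbF.
by move/eqP.
Unshelve. all: by end_near. Qed.

(* An ultrafilter on the indices makes all the sequences [dot (w n) (w m)]
   converge at once, which replaces the diagonal extraction. *)
Lemma bounded_weakly_cvg_subseq (w : nat -> H) (M : R) :
  (forall n, `|w n| <= M) ->
  exists f : nat -> nat, exists2 l, (forall k, (k <= f k)%N) &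
    weakly_cvg dot (w \o f) l.
Proof.
move=> wM.
have M0 : 0 <= M by rewrite (le_trans _ (wM 0%N)).
have dot_wM n s : `|dot (w n) s| <= M * `|s|.
  by rewrite (le_trans (cauchy_schwarz _ _))// ler_wpM2r.
have [U [uU ooU]] := @ultraFilterLemma nat \oo _.
have /choice[phi phiP] m : exists a : R, dot (w n) (w m) @[n --> U] --> a.
  have cpt := @segment_compact R (- (M * `|w m|)) (M * `|w m|).
  have [|a [_ acl]] := cpt (dot (w n) (w m) @[n --> U]) _.
    rewrite nbhs_simpl /=; apply: filterE => n.
    by rewrite /= in_itv /= -ler_norml; exact: dot_wM.
  exists a => V aV.
  (* A cluster point of an ultrafilter is a limit: otherwise the complement of [V] would be large
     and miss [V]. *)
  have [//|UV] := in_ultra_setVsetC ((fun n => dot (w n) (w m)) @^-1` V) uU.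
  by have [b []] := acl (~` V) V UV aV.
(* Only the finitely many conditions [m <= k] are imposed at stage [k], so their intersection stays
   in [U] and is nonempty. *)
have /choice[f fP] k : exists n, (k <= n)%N /\
    forall m : 'I_k.+1, `|phi m - dot (w n) (w m)| < harmonic k.
  suff : U [set n | (k <= n)%N /\
    forall m : 'I_k.+1, `|phi m - dot (w n) (w m)| < harmonic k].
    by move/filter_ex.
  apply: filterI; first by apply: ooU; exists k.
  apply: filter_forall => m.
  by move/cvgrPdist_lt : (phiP m); apply; exact: harmonic_gt0.
(* [S] will be a closed subspace containing every [w m], and [psi] a bounded functional on it,
   represented by the weak limit [l]. *)
pose S := [set s | cvgn (fun k => dot (w (f k)) s)].
pose psi s := limn (fun k => dot (w (f k)) s).
have Sw m : S (w m).
  apply/cvg_ex; exists (phi m); apply/cvgrPdist_lt => e e0.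
  have [N _ NP] := near_infty_natSinv_lt (PosNum e0).
  exists (maxn m N) => //= k /=; rewrite geq_max => /andP[mk Nk].
  have [_ /(_ (Ordinal (mk : m < k.+1)%N)) /= /lt_trans] := fP k; apply.
  exact: NP.
have SD x y : S x -> S y -> dot (w (f k)) (x + y) @[k --> \oo] --> psi x + psi y.
  by move=> Sx Sy; under eq_fun do rewrite dotDr; exact: cvgD.
have SZ a x : S x -> dot (w (f k)) (a *: x) @[k --> \oo] --> a * psi x.
  by move=> Sx; under eq_fun do rewrite dotZr; apply: cvgM => //; exact: cvg_cst.
have S0 : S 0.
  by rewrite -(scale0r (w 0%N)); apply: cvgP (SZ 0 _ (Sw 0%N)).
have clS : closed S.
  move=> s sS; apply/cauchy_cvgP/cauchy_exP => e e0.
  have d0 : 0 < e / 2 / (M + 1) by rewrite !divr_gt0// ltr_wpDl.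
  have [t [St]] := sS _ (nbhsx_ballx s _ d0).
  rewrite -ball_normE /= => st; exists (psi t).
  have e2 : 0 < e / 2 by rewrite divr_gt0.
  move/cvgrPdist_lt : St => /(_ _ e2); apply: filterS => k kt.
  rewrite -ball_normE /=.
  have -> : psi t - dot (w (f k)) s =
    (psi t - dot (w (f k)) t) - dot (w (f k)) (s - t) by rewrite dotBr; ring.
  rewrite (splitr e) (le_lt_trans (ler_normB _ _))// ltr_leD//.
  rewrite (le_trans (dot_wM _ _))// (le_trans (ler_wpM2l M0 (ltW st)))//.
  rewrite mulrA ler_pdivrMr ?ltr_wpDl// mulrC ler_pM2l// lerDl.
  exact: ler01.
have psiM s : S s -> `|psi s| <= M * `|s|.
  move=> Ss; apply: (cvgr_to_le (cvg_norm Ss)).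
  by near=> k; exact: dot_wM.
have SD' x y : S x -> S y -> S (x + y) by move=> *; apply: cvgP; exact: SD.
have SZ' a x : S x -> S (a *: x) by move=> *; apply: cvgP; exact: SZ.
have [||l Sl lP] := @riesz_closed_subspace S psi M clS S0 SD' SZ' _ _ psiM.
- by move=> x y Sx Sy; apply/cvg_lim => //; exact: SD.
- by move=> a x Sx; apply/cvg_lim => //; exact: SZ.
exists f, l => [k|u]; first by case: (fP k).
(* [p] is the orthogonal projection of [u] on [S]; since [l] and all [w m] lie in [S], testing
   against [u] amounts to testing against [p]. *)
have [||s _|p Sp pP] :=
    @riesz_closed_subspace S (dot u) `|u| clS S0 SD' SZ'.
- by move=> *; exact: dotDr.
- by move=> *; exact: dotZr.
- exact: cauchy_schwarz.
under eq_fun do rewrite /= dotC (pP _ (Sw _)) dotC.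
rewrite [dot l u]dotC (pP _ Sl) dotC -lP//.
Unshelve. all: by end_near. Qed.

End InnerProduct.

(** Subsequences are encoded by the growth bound [k <= f k]; this lets limits pass to them. *)
Lemma subseq_cvg_infty (f : nat -> nat) :
  (forall k, (k <= f k)%N) -> f k @[k --> \oo] --> \oo.
Proof.
by move=> kf A [N _ NA]; exists N => // k /= Nk; apply: NA; apply: leq_trans (kf k).
Qed.

(** * Opial's lemma *)

Section Opial.
Context (R : realType) (H : completeNormedModType R) (dot : {dot H for idfun}).
Hypothesis hH : hilbert_norm dot.

(** For cluster points [l], [l'] in [C], [dot (w n) (l - l')] is an affine function of
    [|w n - l'|^2 - |w n - l|^2], so it converges. Its limits along the two subsequences agree,
    which forces [|l - l'|^2 = 0]. *)
Lemma opial_weakly_cvg (w : nat -> H) (C : set H) :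
  C !=set0 -> (forall c, C c -> cvgn (fun n => `|w n - c|)) ->
  (forall f l, (forall k, (k <= f k)%N) -> weakly_cvg dot (w \o f) l -> C l) ->
  exists2 l, C l & weakly_cvg dot w l.
Proof.
move=> [c0 Cc0] wC clusC.
have [M wM] : exists M, forall n, `|w n| <= M.
  have /pinfty_ex_gt0[M M0 /= MP] := cvg_seq_bounded (wC _ Cc0).
  exists (M + `|c0|) => n; have := MP n Logic.I; rewrite normr_id => wcM.
  by rewrite -[w n](subrK c0) (le_trans (ler_normD _ _))// lerD2r.
have cluster_uniq f g l l' : (forall k, (k <= f k)%N) ->
    (forall k, (k <= g k)%N) -> weakly_cvg dot (w \o f) l ->
    weakly_cvg dot (w \o g) l' -> l = l'.
  move=> kf kg wl wl'.
  have [Cl Cl'] := (clusC _ _ kf wl, clusC _ _ kg wl').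
  pose h n := (`|w n - l'| ^+ 2 - `|w n - l| ^+ 2 + dot l l - dot l' l') / 2.
  have hE n : dot (w n) (l - l') = h n.
    rewrite /h -!(dot_norm hH) !dotE [dot l (w n)]dotC [dot l' (w n)]dotC.
    by field.
  have [a ha] : exists a : R, dot (w n) (l - l') @[n --> \oo] --> a.
    rewrite (funext hE).
    have /cvg_ex[a wa] := wC _ Cl; have /cvg_ex[b wb] := wC _ Cl'.
    exists ((b ^+ 2 - a ^+ 2 + dot l l - dot l' l') / 2).
    apply: cvgM; last exact: cvg_cst.
    apply: cvgB; last exact: cvg_cst.
    apply: cvgD; last exact: cvg_cst.
    by apply: cvgB; rewrite expr2; apply: cvgM.
  have al := cvg_comp _ _ (subseq_cvg_infty kf) ha.
  have al' := cvg_comp _ _ (subseq_cvg_infty kg) ha.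
  have la := cvg_unique (@norm_hausdorff _ _) (wl (l - l')) al.
  have l'a := cvg_unique (@norm_hausdorff _ _) (wl' (l - l')) al'.
  apply/eqP; rewrite -subr_eq0; apply/eqP/(dot_eq0 hH).
  by rewrite dotBl la l'a subrr.
have [f [l kf wl]] := bounded_weakly_cvg_subseq hH wM.
exists l; first exact: clusC kf wl.
move=> u; apply: contrapT => wu.
have [e e0 eP] : exists2 e, 0 < e &
    ~ \forall n \near \oo, `|dot l u - dot (w n) u| < e.
  apply: contrapT => eN; apply: wu; apply/cvgrPdist_lt => e e0.
  by apply: contrapT => eP; apply: eN; exists e.
(* Indices staying [e] away from the limit; a weakly convergent subsequence of them must converge to
   [l] by uniqueness, a contradiction. *)
have /choice[g gP] k : exists n, (k <= n)%N /\ ~ `|dot l u - dot (w n) u| < e.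
  apply: contrapT => kN; apply: eP; exists k => // n kn /=.
  by apply: contrapT => nP; apply: kN; exists n.
have [f' [l' kf' wl']] :=
  bounded_weakly_cvg_subseq hH (fun k => wM (g k)).
have kgf' k : (k <= g (f' k))%N.
  by apply: leq_trans (kf' k) _; case: (gP (f' k)).
have := wl' u; rewrite -(cluster_uniq _ (g \o f') _ _ kf kgf' wl wl').
move/cvgrPdist_lt => /(_ _ e0)[N _ /(_ N (leqnn N)) /=].
by case: (gP (f' N)).
Qed.

End Opial.

Lemma series_sqr_unbounded (R : realType) (gamma : nat -> R) :
  (\sum_(0 <= n <oo) (gamma n ^+ 2)%:E = +oo)%E ->
  forall A, exists n, A < \sum_(0 <= i < n) gamma i ^+ 2.
Proof.
move=> goo A; apply: contrapT => gA.
have : (\sum_(0 <= n <oo) (gamma n ^+ 2)%:E <= A%:E)%E.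
  apply: lime_le.
    by apply: is_cvg_nneseries => n _ _; rewrite lee_fin sqr_ge0.
  apply: nearW => n; rewrite sumEFin lee_fin leNgt.
  by apply/negP => An; apply: gA; exists n.
by rewrite goo leye_eq.
Qed.

(** * Fejér estimates and weak convergence of the iteration *)

Section WarpedProximalPoint.
Context (R : realType) (H : completeNormedModType R) (dot : {dot H for idfun}).
Hypothesis hH : hilbert_norm dot.
Context (F : H -> set H) (gamma : nat -> R) (v : H -> H) (x : nat -> H).
Hypothesis gamma_gt0 : forall n, 0 < gamma n.
Hypothesis v_inj : injective v.
Hypothesis mono : monotone_pair dot F v.
Hypothesis ran_sub : forall n, range v `<=` ran (warped_sum (gamma n) F v).
Hypothesis xE : forall n, x n.+1 = warped_resolvent (gamma n) F v (x n).

Let u n := (gamma n)^-1 *: (v (x n) - v (x n.+1)).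

Lemma warped_residual n : F (x n.+1) (u n).
Proof.
have := warped_resolvent_setE (gamma_gt0 n) mono v_inj (@ran_sub n) (x n).
move/seteqP => [_ /(_ _ erefl)]; rewrite -xE => -[w Fw vx].
by rewrite /u -vx addrK scalerA mulVf ?gt_eqF// scale1r.
Qed.

Lemma warped_step n : v (x n) - v (x n.+1) = gamma n *: u n.
Proof. by rewrite /u scalerA divff ?gt_eqF// scale1r. Qed.

(** Kept as an equality: the cross term is dropped for the Fejér bound and exploited under strong
    monotonicity. *)
Lemma warped_step_sqr z n : `|v (x n) - v z| ^+ 2 =
  `|v (x n.+1) - v z| ^+ 2 + gamma n ^+ 2 * `|u n| ^+ 2 +
  2 * gamma n * dot (u n) (v (x n.+1) - v z).
Proof.
have -> : v (x n) - v z = gamma n *: u n + (v (x n.+1) - v z).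
  by rewrite -warped_step addrA subrK.
rewrite -!(dot_norm hH); move: (u n) (v _ - v z) => r y.
by rewrite !dotE [dot y r]dotC; ring.
Qed.

Lemma warped_fejer z n : zer F z ->
  `|v (x n.+1) - v z| ^+ 2 + gamma n ^+ 2 * `|u n| ^+ 2 <=
  `|v (x n) - v z| ^+ 2.
Proof.
move=> Fz; rewrite (warped_step_sqr z n) lerDl mulr_ge0//.
  by rewrite mulr_ge0// ltW.
by rewrite -[u n]subr0; exact: mono (warped_residual n) Fz.
Qed.

Lemma warped_dist_nonincreasing z : zer F z ->
  {homo (fun n => `|v (x n) - v z|) : m n / (m <= n)%N >-> n <= m}.
Proof.
move=> Fz; apply/nonincreasing_seqP => n.
rewrite -ler_sqr ?nnegrE//; apply: le_trans (warped_fejer n Fz).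
by rewrite lerDl mulr_ge0 ?sqr_ge0.
Qed.

Lemma warped_dist_cvg z : zer F z -> cvgn (fun n => `|v (x n) - v z|).
Proof.
move=> Fz; apply: nonincreasing_is_cvgn (warped_dist_nonincreasing Fz) _.
by exists 0 => _ [n _ <-].
Qed.

(** As [v (x n.+2) - v (x n.+1)] is a negative multiple of [u n.+1], monotonicity gives
    [|u n.+1|^2 <= dot (u n) (u n.+1)]; conclude by Cauchy-Schwarz. *)
Lemma warped_residual_nonincreasing :
  {homo (fun n => `|u n|) : m n / (m <= n)%N >-> n <= m}.
Proof.
apply/nonincreasing_seqP => n.
have := mono (warped_residual n.+1) (warped_residual n).
rewrite -[v _ - v _]opprB warped_step.
move: (u n.+1) (u n) => a b; rewrite -scaleNr dotZr mulNr oppr_ge0 pmulr_rle0//.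
rewrite dotBl subr_le0 (dot_norm hH) => /le_trans/(_ (dot_le hH _ _)).
have [->//|a0] := eqVneq (`|a|) 0.
by rewrite expr2 [leRHS]mulrC ler_pM2l// lt_def a0 normr_ge0.
Qed.

Lemma warped_residual_sum z n : zer F z ->
  (\sum_(0 <= i < n) gamma i ^+ 2 * `|u i| ^+ 2) + `|v (x n) - v z| ^+ 2 <=
  `|v (x 0%N) - v z| ^+ 2.
Proof.
move=> Fz; elim: n => [|n IH]; first by rewrite big_geq ?add0r.
rewrite big_nat_recr//=; apply: le_trans IH.
by rewrite -addrA lerD2l addrC warped_fejer.
Qed.

Lemma warped_residual_cvg0 z : zer F z ->
  (\sum_(0 <= n <oo) (gamma n ^+ 2)%:E = +oo)%E -> u n @[n --> \oo] --> 0.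
Proof.
move=> Fz /series_sqr_unbounded gunb.
apply/cvgr0Pnorm_le => e e0.
(* A residual above [e] past [N] would force all earlier ones above [e], and the first [N] terms
   would exceed the bound of [warped_residual_sum]. *)
have [N] := gunb (`|v (x 0%N) - v z| ^+ 2 / e ^+ 2).
rewrite ltr_pdivrMr ?exprn_gt0// => DN.
exists N => // n /= Nn; rewrite leNgt; apply/negP => eu.
have := warped_residual_sum N Fz; rewrite leNgt => /negP; apply.
apply: (lt_le_trans DN); rewrite mulr_suml ler_wpDr ?sqr_ge0//.
rewrite big_nat_cond [leRHS]big_nat_cond.
apply: ler_sum => i /andP[/andP[_ iN] _].
rewrite ler_wpM2l ?sqr_ge0// ler_sqr ?nnegrE// ?(ltW e0)//.
rewrite (le_trans (ltW eu))// warped_residual_nonincreasing//.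
by rewrite (leq_trans (ltnW iN)).
Qed.

Lemma warped_weak_cvg (vinv : H -> H) : zer F !=set0 ->
  strongly_weakly_closed dot F -> cancel v vinv -> cancel vinv v ->
  weakly_continuous dot vinv ->
  (\sum_(0 <= n <oo) (gamma n ^+ 2)%:E = +oo)%E ->
  exists2 xs, zer F xs & weakly_cvg dot x xs.
Proof.
move=> [z Fz] Fclosed vK vinvK vinvC goo.
have xvinv (f : nat -> nat) : vinv \o (v \o x \o f) = x \o f.
  by apply/funext => n /=; rewrite vK.
(* The target set is [v (zer F)], written as a preimage under [vinv]. *)
have [||f l kf wl|l Fl vl] :=
    @opial_weakly_cvg _ _ dot hH (v \o x) [set c | zer F (vinv c)].
- by exists (v z); rewrite /= vK.
- by move=> c Fc; rewrite -[c]vinvK; exact: warped_dist_cvg.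
- have xl : weakly_cvg dot (x \o f) (vinv l) by rewrite -xvinv; exact: vinvC.
  (* [u n] lies in [F (x n.+1)], so indices are lowered by one; starting from [f 1], which is
     positive, makes every predecessor genuine. *)
  pose f' k := (f k.+1).-1.
  have f'E k : (f' k).+1 = f k.+1 by rewrite prednK// (leq_ltn_trans _ (kf _)).
  apply: (Fclosed (fun k => x (f' k).+1) (u \o f')).
  + by move=> k; exact: warped_residual.
  + move=> s; under eq_fun do rewrite f'E.
    by have := xl s; rewrite -cvg_shiftS.
  + apply: cvg_comp (warped_residual_cvg0 Fz goo).
    by apply: subseq_cvg_infty => k; rewrite -ltnS f'E.
- by exists (vinv l) => //; rewrite -[x]/(x \o id) -xvinv; exact: vinvC.
Qed.

(** * Strong convergence and linear rates *)

Section StronglyMonotone.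
Context (alpha : R).
Hypothesis alpha_gt0 : 0 < alpha.
Hypothesis smono : strongly_monotone_pair dot alpha F v.
Hypothesis inf_gt0 : 0 < inf (range gamma).

Lemma gamma_ge_inf n : inf (range gamma) <= gamma n.
Proof. by apply: ge_inf; [exists 0 => _ [m _ <-]; exact: ltW|exists n]. Qed.

Lemma zer_uniq y z : zer F y -> zer F z -> y = z.
Proof.
move=> Fy Fz; have := smono Fy Fz.
rewrite subr0 linear0l pmulr_rle0// => yz.
apply/eqP; rewrite -subr_eq0 -normr_eq0 -sqrf_eq0.
by rewrite eq_le yz sqr_ge0.
Qed.

Lemma residual_dot_ge z n : zer F z ->
  alpha * `|x n.+1 - z| ^+ 2 <= dot (u n) (v (x n.+1) - v z).
Proof.
by move=> Fz; rewrite -[u n]subr0; exact: smono (warped_residual n) Fz.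
Qed.

(** The decrements of the convergent sequence [|v (x n) - v z|^2] tend to 0 and dominate a fixed
    multiple of [|x n.+1 - z|^2]. *)
Lemma warped_strong_cvg z : zer F z -> x n @[n --> \oo] --> z.
Proof.
move=> Fz; pose g := inf (range gamma).
pose d n := `|v (x n) - v z| ^+ 2.
have dxz n : 2 * g * alpha * `|x n.+1 - z| ^+ 2 <= d n - d n.+1.
  have := residual_dot_ge n Fz; have := warped_step_sqr z n.
  rewrite /d => ->; set p := dot _ _ => ap.
  have gn := gamma_ge_inf n.
  have p0 : 0 <= p by apply: le_trans ap; rewrite mulr_ge0 ?sqr_ge0// ltW.
  have h1 : 0 <= gamma n ^+ 2 * `|u n| ^+ 2 by rewrite mulr_ge0 ?sqr_ge0.
  have h2 : g * (alpha * `|x n.+1 - z| ^+ 2) <= gamma n * p.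
    by rewrite ler_pM ?(ltW inf_gt0)// mulr_ge0 ?sqr_ge0// ltW.
  lra.
have dcvg : d n - d n.+1 @[n --> \oo] --> 0.
  have /cvg_ex[a wa] := warped_dist_cvg Fz.
  have da : d n @[n --> \oo] --> a ^+ 2.
    by rewrite /d; under eq_fun do rewrite expr2; exact: cvgM.
  by rewrite -(subrr (a ^+ 2)); apply: cvgB => //; rewrite -cvg_shiftS in da.
rewrite -cvg_shiftS; apply/cvgrPdist_le => e e0.
have c0 : 0 < 2 * g * alpha by rewrite !mulr_gt0.
have ce0 : 0 < 2 * g * alpha * e ^+ 2 by rewrite mulr_gt0// exprn_gt0.
move/cvgr0Pnorm_le : dcvg => /(_ _ ce0); apply: filterS => n dn.
rewrite distrC -ler_sqr ?nnegrE// ?(ltW e0)//.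
rewrite -(ler_pM2l c0) (le_trans (dxz n))// (le_trans _ dn)//.
exact: ler_norm.
Qed.

Lemma warped_linear_rate z L : zer F z -> 0 < L -> L.-lipschitz v ->
  forall n, `|v (x n.+1) - v z| <=
    1 / (1 + alpha * inf (range gamma) * L ^- 2) * `|v (x n) - v z|.
Proof.
move=> Fz L0 vL n; set g := inf _.
have vLip a b : `|v a - v b| <= L * `|a - b| by apply: (vL (a, b)).
have k0 : 0 <= alpha * g * L ^- 2.
  by rewrite !mulr_ge0 ?ltW// invr_gt0 exprn_gt0.
rewrite div1r mulrC ler_pdivlMr; last by rewrite ltr_wpDr.
have [->|y0] := eqVneq (`|v (x n.+1) - v z|) 0; first by rewrite mul0r.
have y_gt0 : 0 < `|v (x n.+1) - v z| by rewrite lt_def y0 normr_ge0.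
(* Pairing [v (x n) - v z] with [v (x n.+1) - v z] turns the claim into a lower bound on
   [dot (u n) (v (x n.+1) - v z)]; the Lipschitz bound converts [|x n.+1 - z|] into
   [|v (x n.+1) - v z| / L]. *)
rewrite -(ler_pM2r y_gt0); apply: le_trans (dot_le hH _ _).
have -> : v (x n) - v z = gamma n *: u n + (v (x n.+1) - v z).
  by rewrite -warped_step addrA subrK.
rewrite dotDl dotZl (dot_norm hH).
set y := `|v _ - v z|; set r := L ^- 2.
have -> : y * (1 + alpha * g * r) * y = g * (alpha * (y ^+ 2 * r)) + y ^+ 2.
  by ring.
rewrite lerD2r.
apply: ler_pM; [exact: ltW|by rewrite !mulr_ge0 ?ltW ?invr_gt0 ?exprn_gt0| |].
  exact: gamma_ge_inf.
apply: le_trans (residual_dot_ge n Fz); rewrite ler_pM2l//.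
rewrite ler_pdivrMr ?exprn_gt0// mulrC -exprMn ler_sqr ?nnegrE ?normr_ge0//.
  exact: vLip.
by rewrite mulr_ge0// ltW.
Qed.

End StronglyMonotone.
End WarpedProximalPoint.

Theorem theorem4p2 (R : realType) (H : completeNormedModType R)
    (dot : {dot H for idfun}) (hH : hilbert_norm dot)
    (F : H -> set H) (hzer : zer F !=set0)
    (gamma : nat -> R) (hgamma : forall n, 0 < gamma n)
    (v : H -> H) (hv : injective v) (hmono : monotone_pair dot F v)
    (hran : forall n, range v `<=` ran (warped_sum (gamma n) F v))
    (x : nat -> H)
    (hx : forall n, x n.+1 = warped_resolvent (gamma n) F v (x n)) :
  (* (i) *)
  (forall vinv : H -> H,
    strongly_weakly_closed dot F ->
    cancel v vinv -> cancel vinv v -> weakly_continuous dot vinv ->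
    (\sum_(0 <= n <oo) (gamma n ^+ 2)%:E = +oo)%E ->
    exists2 xs : H, zer F xs & weakly_cvg dot x xs)
  /\
  (* (ii) *)
  (forall alpha : R,
    0 < alpha -> strongly_monotone_pair dot alpha F v ->
    0 < inf (range gamma) ->
    exists xs : H,
      [/\ zer F = [set xs],
          x n @[n --> \oo] --> xs,
          (* (a) *)
          (forall L : R, 0 < L -> L.-lipschitz v ->
            forall n, `|v (x n.+1) - v xs| <=
              1 / (1 + alpha * inf (range gamma) * L ^- 2) *
                `|v (x n) - v xs|) &
          (* (b) *)
          (forall (L l : R) (vinv : H -> H),
            0 < L -> L.-lipschitz v ->
            cancel v vinv -> cancel vinv v -> l.-lipschitz vinv ->
            exists C kappa : R,
              [/\ 0 <= C, 0 < kappa < 1 &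
                  forall n, `|x n - xs| <= C * kappa ^+ n])]).
Proof.
split=> [vinv|alpha a0 smono g0]; first exact: warped_weak_cvg.
have [z Fz] := hzer.
have rate L L0 vL := @warped_linear_rate R H dot hH F gamma v x hgamma hv hmono
  hran hx alpha a0 smono g0 z L Fz L0 vL.
exists z; split.
- by apply/seteqP; split=> [y Fy|_ ->//]; exact: zer_uniq smono _ _ Fy Fz.
- exact: (@warped_strong_cvg R H dot hH F gamma v x hgamma hv hmono hran hx
    alpha a0 smono g0).
- exact: rate.
- move=> L l vinv L0 vL vK _ vinvL.
  have vinvLip a b : `|vinv a - vinv b| <= l * `|a - b| by apply: (vinvL (a, b)).
  set k := 1 / (1 + alpha * inf (range gamma) * L ^- 2).
  have c0 : 0 < alpha * inf (range gamma) * L ^- 2.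
    by rewrite !mulr_gt0// invr_gt0 exprn_gt0.
  have k0 : 0 < k by rewrite divr_gt0// addr_gt0.
  (* Iterate the rate of (a) and pull back through [vinv]; the absolute value makes the constant
     nonnegative, as [l] carries no sign condition. *)
  exists (`|l| * `|v (x 0%N) - v z|), k; split.
  + by rewrite mulr_ge0.
  + by rewrite k0 /= /k ltr_pdivrMr ?addr_gt0// mul1r ltrDl.
  + move=> n; rewrite -[x n]vK -[z in leLHS]vK (le_trans (vinvLip _ _))//.
    rewrite (le_trans (ler_wpM2r _ (ler_norm l)))// -mulrA ler_wpM2l//.
    elim: n => [|n IH]; first by rewrite expr0 mulr1.
    apply: le_trans (rate L L0 vL n) _.
    by rewrite -/k [k ^+ _]exprS mulrCA ler_pM2l.
Qed.
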